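(* Let $n \ge 2$ be an integer and let $G = L(S(S_n))$ be the line graph of the subdivision graph of the star $S_n$ with $n$ vertices. Then the F-coindex of $G$ is $\overline{F}(G) = (n-1)(n-2)(n^2-2n+3)$.
   Context: For a simple graph $H$, $d(u)$ denotes the degree of a vertex $u$ in $H$. The F-coindex of $H$ is $\overline{F}(H) = \sum_{uv \notin E(H)} [d^2(u)+d^2(v)]$, the sum being over unordered pairs of distinct non-adjacent vertices $u,v$ of $H$. The subdivision graph $S(H)$ is the graph obtained from $H$ by inserting one additional vertex into each edge of $H$ (each edge is replaced by a path of length 2). The line graph $L(H)$ is the simple graph whose vertices are the edges of $H$, two distinct ones being adjacent when they share a common endpoint in $H$. $S_n$ is the star on $n$ vertices: one central vertex joined to $n-1$ leaves. *)

(* Defs.v *)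
From mathcomp Require Import all_boot all_order all_algebra.
Set Implicit Arguments.
Unset Strict Implicit.
Unset Printing Implicit Defensive.

Record sgraph := SGraph {
  vertex :> finType;
  adj : rel vertex;
  adj_sym : symmetric adj;
  adj_irr : irreflexive adj }.

Definition degree (H : sgraph) (u : H) : nat := #|[set v : H | adj u v]|.

(* Edges are the unordered pairs {u, v} of adjacent vertices. *)
Definition edges (H : sgraph) : {set {set H}} :=
  [set e : {set H} | [exists u : H, exists v : H, adj u v && (e == [set u; v])]].

Definition edge (H : sgraph) : finType := {e : {set H} | e \in edges H}.

(* The outer sum ranges over the two-element vertex sets p = {u, v} that are not
   edges, each unordered pair once; the inner sum is d(u)^2 + d(v)^2. *)
Definition F_coindex (H : sgraph) : nat :=
  \sum_(p : {set H} | (#|p| == 2) && (p \notin edges H))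
    \sum_(u in p) degree u ^ 2.

Definition line_adj (H : sgraph) : rel (edge H) :=
  fun e f => (e != f) && [exists x : H, (x \in val e) && (x \in val f)].

Lemma line_adj_sym (H : sgraph) : symmetric (@line_adj H).
Proof.
move=> e f; rewrite /line_adj eq_sym; congr (_ && _).
by apply: eq_existsb => x; rewrite andbC.
Qed.

Lemma line_adj_irr (H : sgraph) : irreflexive (@line_adj H).
Proof. by move=> e; rewrite /line_adj eqxx. Qed.

Definition line_graph (H : sgraph) : sgraph :=
  SGraph (@line_adj_sym H) (@line_adj_irr H).

(* inl v is an original vertex, inr e the vertex inserted into the edge e. *)
Definition subdiv_adj (H : sgraph) : rel (H + edge H)%type :=
  fun a b => match a, b with
  | inl v, inr e => v \in val e
  | inr e, inl v => v \in val e
  | _, _ => false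
  end.

Lemma subdiv_adj_sym (H : sgraph) : symmetric (@subdiv_adj H).
Proof. by move=> [u|e] [v|f]. Qed.

Lemma subdiv_adj_irr (H : sgraph) : irreflexive (@subdiv_adj H).
Proof. by move=> [u|e]. Qed.

Definition subdivision (H : sgraph) : sgraph :=
  SGraph (@subdiv_adj_sym H) (@subdiv_adj_irr H).

(* The centre of the star on n vertices is the ordinal of value 0. *)
Definition star_adj (n : nat) : rel 'I_n :=
  fun i j => (i != j) && ((val i == 0) || (val j == 0)).

Lemma star_adj_sym (n : nat) : symmetric (@star_adj n).
Proof. by move=> i j; rewrite /star_adj eq_sym orbC. Qed.

Lemma star_adj_irr (n : nat) : irreflexive (@star_adj n).
Proof. by move=> i; rewrite /star_adj eqxx. Qed.

Definition star (n : nat) : sgraph :=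
  SGraph (@star_adj_sym n) (@star_adj_irr n).

(* Main.v *)
Require Import Defs.
From mathcomp Require Import all_boot all_order all_algebra.
From mathcomp Require Import zify.
Import GRing.Theory Num.Theory.
Local Open Scope ring_scope.

(** Write m = n - 1.  The F-coindex counts the square of the degree of a vertex
    once for each of its non-neighbours, hence equals the sum over the vertices u
    of d(u)^2 (N - 1 - d(u)), where N is the order of the graph
    ([F_coindex_sum]).

    For the line graph of the subdivision of any graph H this sum can be
    written in terms of H alone.  An edge of S(H) joins an original vertex v to a
    subdividing vertex, which has degree 2; since an edge xy has degree
    d(x) + d(y) - 2 in the line graph, such an edge has degree
    d(v) + 2 - 2 = d(v) ([degree_line_subdivision]).  Exactly d(v) edges of S(H)
    contain v, so that N is the degree sum of H, and
    [F_coindex_line_subdivision] follows: the F-coindex of L(S(H)) is the sum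
    over the vertices v of H of d(v)^3 (N - 1 - d(v)).

    In the star the centre has degree m and the m leaves have degree 1, so
    N = 2m and the value is m^3 (m - 1) + m (2m - 2) = m (m - 1) (m^2 + 2). *)

Local Open Scope nat_scope.

(** * Edges at a vertex *)

Lemma edgesP (H : sgraph) (p : {set H}) :
  reflect (exists u v, adj u v /\ p = [set u; v]) (p \in edges H).
Proof.
rewrite inE; apply: (iffP existsP) => [[u /existsP[v /andP[uv /eqP->]]]|].
  by exists u, v.
by case=> u [v [uv ->]]; exists u; apply/existsP; exists v; rewrite uv eqxx.
Qed.

Lemma adj_neq (H : sgraph) (u v : H) : adj u v -> u != v.
Proof. by apply: contraTneq => ->; rewrite adj_irr. Qed.

Lemma edge_at (H : sgraph) (u : H) (p : {set H}) :
  p \in edges H -> u \in p -> exists2 v, adj u v & p = [set u; v].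
Proof.
case/edgesP=> x [y [xy ->]]; rewrite !inE => /orP[]/eqP->; first by exists y.
by exists x; rewrite 1?adj_sym // setUC.
Qed.

Lemma mem_edges2 (H : sgraph) (u v : H) : ([set u; v] \in edges H) = adj u v.
Proof.
apply/idP/idP => [uvE | uv]; last by apply/edgesP; exists u, v.
have [w uw def_uv] := edge_at _ u _ uvE (set21 u v).
have: w \in [set u; v] by rewrite def_uv set22.
by rewrite !inE eq_sym (negbTE (adj_neq _ _ _ uw)) => /eqP<-.
Qed.

(** Through the endpoint other than [u], the edges at [u] correspond to the
    neighbours of [u]. *)
Lemma card_edges_at (H : sgraph) (u : H) :
  #|[set p in edges H | u \in p]| = degree u.
Proof.
rewrite /degree -(@card_in_imset _ _ (fun v => [set u; v])) => [|v w].
  apply: eq_card => p; rewrite inE; apply/andP/imsetP => [[pE up]|[v]].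
    by have [v uv ->] := edge_at _ _ _ pE up; exists v; rewrite ?inE.
  by rewrite inE => uv ->; rewrite mem_edges2 set21.
rewrite !inE => uv uw /setP/(_ v).
by rewrite !inE eqxx orbT eq_sym (negbTE (adj_neq _ _ _ uv)) => /esym/eqP.
Qed.

Lemma card_incident (H : sgraph) (u : H) :
  #|[set e : edge H | u \in val e]| = degree u.
Proof.
rewrite -card_edges_at -(card_imset _ val_inj); apply: eq_card => p.
rewrite inE; apply/imsetP/andP => [[e]|[pE up]].
  by rewrite inE => ue ->; split=> //; apply: (valP e).
by exists (Sub p pE : edge H); rewrite ?inE.
Qed.

(** * The F-coindex as a sum over vertices *)

Definition compl_adj (H : sgraph) : rel H :=
  fun u v => (u != v) && ~~ adj u v.

Lemma compl_adj_sym (H : sgraph) : symmetric (@compl_adj H).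
Proof. by move=> u v; rewrite /compl_adj eq_sym adj_sym. Qed.

Lemma compl_adj_irr (H : sgraph) : irreflexive (@compl_adj H).
Proof. by move=> u; rewrite /compl_adj eqxx. Qed.

Definition compl (H : sgraph) : sgraph :=
  SGraph (@compl_adj_sym H) (@compl_adj_irr H).

Lemma mem_edges_compl (H : sgraph) (p : {set H}) :
  (p \in edges (compl H)) = (#|p| == 2) && (p \notin edges H).
Proof.
apply/idP/andP => [/edgesP[u [v [/andP[uv nuv] ->]]]|[/cards2P[u [v [uv ->]]]]].
  by rewrite (@mem_edges2 H) cards2 uv.
by rewrite mem_edges2 (@mem_edges2 (compl H)) /= /compl_adj uv.
Qed.

Lemma degree_compl (H : sgraph) (u : H) :
  @degree (compl H) u = #|H|.-1 - degree u.
Proof.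
rewrite {1}/degree; set C := [set _ | _].
have -> : C = ~: (u |: [set v | adj u v]).
  by apply/setP=> v; rewrite !inE /= /compl_adj negb_or eq_sym.
by rewrite cardsCs setCK cardsU1 inE adj_irr add1n -subn1 -subnDA add1n.
Qed.

(** The non-edges are the edges of the complement, so those at [u] are counted
    by the degree of [u] in the complement. *)
Lemma F_coindex_sum (H : sgraph) :
  F_coindex H = \sum_(u : H) degree u ^ 2 * (#|H|.-1 - degree u).
Proof.
rewrite /F_coindex (eq_bigl _ _ (fun p => esym (mem_edges_compl H p))).
rewrite (exchange_big_dep xpredT) //=; apply: eq_bigr => u _.
rewrite sum_nat_const mulnC -degree_compl -(card_edges_at (compl H)).
by rewrite cardsE.
Qed.

(** * Degrees in line graphs and subdivisions *)

(** The edges at [u] and those at [v] overlap in the edge [uv] alone, which is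
    counted twice on the right and not at all as its own neighbour. *)
Lemma degree_line (H : sgraph) (e : edge H) (u v : H) :
  adj u v -> val e = [set u; v] ->
  @degree (line_graph H) e + 2 = degree u + degree v.
Proof.
move=> uv def_e; rewrite -(card_incident H u) -(card_incident H v) -cardsUI.
set A := [set f | u \in _]; set B := [set f | v \in _].
have AB1 : A :&: B = [set e].
  apply/setP=> f; rewrite !inE; apply/andP/eqP => [[uf vf]|->]; last first.
    by rewrite def_e set21 set22.
  apply: val_inj; rewrite def_e.
  have [w uw def_f] := edge_at _ _ _ (valP f) uf.
  move: vf; rewrite def_f !inE eq_sym (negbTE (adj_neq _ _ _ uv)).
  by move/eqP->.
have eAB : e \in A :|: B by rewrite !inE def_e set21.
have nbE : [set f : edge H | line_adj e f] = (A :|: B) :\ e.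
  apply/setP=> f; rewrite !inE /line_adj eq_sym; congr (_ && _).
  apply/existsP/orP => [[x]|[xf|xf]].
  - by rewrite def_e !inE => /andP[/orP[]/eqP-> xf]; [left | right].
  - by exists u; rewrite def_e set21.
  - by exists v; rewrite def_e set22.
transitivity (#|[set f : edge H | line_adj e f]| + 2) => //.
by rewrite nbE AB1 cards1 (cardsD1 e (A :|: B)) eAB addnC addnAC.
Qed.

Lemma degree_subdiv_vertex (H : sgraph) (v : H) :
  @degree (subdivision H) (inl v) = degree v.
Proof.
rewrite -(card_incident H v) /degree -(card_imset _ (@inr_inj H (edge H))).
apply: eq_card => -[w|e]; rewrite !inE.
  by symmetry; apply/imsetP=> -[].
by rewrite mem_imset ?inE //; apply: inr_inj.
Qed.

Lemma degree_subdiv_edge (H : sgraph) (e : edge H) :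
  @degree (subdivision H) (inr e) = 2.
Proof.
have [u [v [uv def_e]]] := edgesP _ _ (valP e).
have <-: #|val e| = 2 by rewrite def_e cards2 (adj_neq _ _ _ uv).
rewrite /degree -(card_imset _ (@inl_inj H (edge H))).
apply: eq_card => -[w|f]; rewrite !inE.
  by rewrite mem_imset //; apply: inl_inj.
by symmetry; apply/imsetP=> -[].
Qed.

Lemma subdiv_edgeP (H : sgraph) (a : edge (subdivision H)) :
  exists v (e : edge H),
    @adj (subdivision H) (inl v) (inr e) /\ val a = [set inl v; inr e].
Proof.
have [[u|e] [[v|f] [//= uv def_a]]] := edgesP _ _ (valP a).
  by exists u, f.
by exists v, e; rewrite setUC.
Qed.

(** An edge of the subdivision has a single endpoint among the original
    vertices.  Taking the sum over that endpoint turns a sum over the edges of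
    the subdivision into one over incidences, which can then be grouped by
    vertices. *)
Lemma sum_subdiv_edge (H : sgraph) (F : H -> nat) :
  \sum_(a : edge (subdivision H)) \sum_(v : H | inl v \in val a) F v =
  \sum_(v : H) degree v * F v.
Proof.
rewrite (exchange_big_dep xpredT) //=; apply: eq_bigr => v _.
rewrite sum_nat_const -degree_subdiv_vertex -card_incident.
by congr (_ * _); apply: eq_card => a; rewrite !inE.
Qed.

Lemma big_subdiv_end {H : sgraph} {a : edge (subdivision H)} {v : H}
    {e : edge H} (F : H -> nat) :
  val a = [set inl v; inr e] -> \sum_(w : H | inl w \in val a) F w = F v.
Proof.
move=> def_a; apply: big_pred1 => w.
by rewrite def_a !inE orbF; apply: inj_eq; apply: inl_inj.
Qed.

Lemma degree_line_subdivision (H : sgraph) (a : edge (subdivision H)) (v : H)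
    (e : edge H) :
  @adj (subdivision H) (inl v) (inr e) -> val a = [set inl v; inr e] ->
  @degree (line_graph (subdivision H)) a = degree v.
Proof.
move=> ve def_a; have := degree_line _ _ _ _ ve def_a.
by rewrite degree_subdiv_vertex degree_subdiv_edge => /addIn.
Qed.

Lemma card_line_subdivision (H : sgraph) :
  #|line_graph (subdivision H)| = \sum_(v : H) degree v.
Proof.
under [RHS]eq_bigr do rewrite -[degree _]muln1.
rewrite -sum_subdiv_edge -sum1_card; apply: eq_bigr => a _.
by have [v [e [_ /big_subdiv_end->]]] := subdiv_edgeP _ a.
Qed.

Lemma F_coindex_line_subdivision (H : sgraph) :
  F_coindex (line_graph (subdivision H)) =
  \sum_(v : H) degree v ^ 3 * ((\sum_(u : H) degree u).-1 - degree v).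
Proof.
rewrite F_coindex_sum card_line_subdivision.
under [RHS]eq_bigr do rewrite expnS -mulnA.
rewrite -sum_subdiv_edge; apply: eq_bigr => a _.
have [v [e [ve def_a]]] := subdiv_edgeP _ a.
by rewrite (big_subdiv_end _ def_a) (degree_line_subdivision _ _ _ _ ve def_a).
Qed.

(** * The star *)

Lemma degree_star_centre (m : nat) : @degree (star m.+1) ord0 = m.
Proof.
rewrite /degree (_ : [set v | _] = [set~ ord0]) ?cardsC1 ?card_ord //.
by apply/setP=> i; rewrite !inE /= /star_adj andbT eq_sym.
Qed.

Lemma degree_star_leaf (m : nat) (i : 'I_m) :
  @degree (star m.+1) (lift ord0 i) = 1.
Proof.
rewrite /degree (_ : [set v | _] = [set ord0]) ?cards1 //.
apply/setP=> j; rewrite !inE /= /star_adj.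
by case: (unliftP ord0 j) => [k|] ->; rewrite ?andbF ?andbT.
Qed.

Lemma sum_star (m : nat) (F : nat -> nat) :
  \sum_(v : star m.+1) F (degree v) = F m + m * F 1.
Proof.
rewrite big_ord_recl degree_star_centre; congr (_ + _).
under eq_bigr do rewrite degree_star_leaf.
by rewrite sum_nat_const card_ord.
Qed.

Local Open Scope ring_scope.

Theorem theorem4 (n : nat) (hn : (2 <= n)%N) :
  (F_coindex (line_graph (subdivision (star n))))%:Z =
  (n%:Z - 1) * (n%:Z - 2) * (n%:Z ^+ 2 - 2 * n%:Z + 3).
Proof.
case: n hn => [|[|k]] // _; rewrite F_coindex_line_subdivision.
rewrite (sum_star k.+1 id).
rewrite (sum_star k.+1 (fun d => (d ^ 3 * ((k.+1 + k.+1 * 1).-1 - d))%N)).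
(* With m = k + 1, an edge of S(S_n) at the centre is disjoint from 2m - 1 - m = k
   others, and one at a leaf from 2m - 1 - 1 = 2k. *)
have -> : ((k.+1 + k.+1 * 1).-1 - k.+1 = k)%N by lia.
have -> : ((k.+1 + k.+1 * 1).-1 - 1 = k.*2)%N by lia.
rewrite -mul2n; lia.
Qed.
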